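(* Let $L\ge 1$ be an integer. The maximum error of the depth-$L$ NMDT MIP relaxation $P_{\mathrm{NMDT}}$ for $z=xy$ with $x,y\in[0,1]$ is $$\mathcal E^{\max}\bigl(P_{\mathrm{NMDT}},\operatorname{gra}_{[0,1]^2}(xy)\bigr)=\tfrac14\,(2^{-L}\cdot 1)=2^{-L-2}.$$
   Context: McCormick envelope: for variables $p\in[\underline p,\overline p]$, $q\in[\underline q,\overline q]$, $\mathcal M(p,q)$ denotes the set of $(p,q,r)\in[\underline p,\overline p]\times[\underline q,\overline q]\times\mathbb R$ with $\underline p q+p\underline q-\underline p\,\underline q\le r\le \overline p q+p\underline q-\overline p\,\underline q$ and $\overline p q+p\overline q-\overline p\,\overline q\le r\le \underline p q+p\overline q-\underline p\,\overline q$. For a binary variable the bounds used are $[0,1]$. Depth-$L$ NMDT MIP relaxation $P_{\mathrm{NMDT}}$ of $z=xy$: the set of all $(x,y,z,\Delta_x,\Delta_z,u,\beta)$ with $x,z,\Delta_z\in\mathbb R$, $u\in\mathbb R^L$, satisfying $x=\sum_{j=1}^L2^{-j}\beta_j+\Delta_x$; $z=\sum_{j=1}^L2^{-j}u_j+\Delta_z$; $(y,\beta_j,u_j)\in\mathcal M(y,\beta_j)$ for $j=1,\dots,L$; $(\Delta_x,y,\Delta_z)\in\mathcal M(\Delta_x,y)$; $\Delta_x\in[0,2^{-L}]$, $y\in[0,1]$, $\beta\in\{0,1\}^L$. (The bounds in the McCormick envelopes are $y\in[0,1]$ and $\Delta_x\in[0,2^{-L}]$.) Let $\operatorname{gra}_{[0,1]^2}(xy)=\{(x,y,z)\in[0,1]^2\times\mathbb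 R: z=xy\}$. The maximum error $\mathcal E^{\max}(P,\operatorname{gra}_{[0,1]^2}(xy))$ is the maximum of $|z-xy|$ over all $(x,y,z)$ in the projection of $P$ onto the $(x,y,z)$-space. *)

(* Defs.v *)
From mathcomp Require Import all_boot all_order all_algebra.
From mathcomp Require Import all_classical all_reals.
Set Implicit Arguments.
Unset Strict Implicit.
Unset Printing Implicit Defensive.
Import Order.TTheory GRing.Theory Num.Theory.
Local Open Scope classical_set_scope.
Local Open Scope ring_scope.

(* Set of points (p, q, r); [pl, pu] and [ql, qu] are the bounds on p and q. *)
Definition mccormick (R : realType) (pl pu ql qu : R) : set (R * R * R) :=
  [set t | let: (p, q, r) := t in
    [/\ pl <= p <= pu, ql <= q <= qu,
        pl * q + p * ql - pl * ql <= r <= pu * q + p * ql - pu * ql &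
        pu * q + p * qu - pu * qu <= r <= pl * q + p * qu - pl * qu]].

Record nmdt_point (R : realType) (L : nat) := NMDTPoint {
  nx : R;
  ny : R;
  nz : R;
  nDx : R;
  nDz : R;
  nu : 'rV[R]_L;
  nbeta : 'rV[R]_L
}.

(* The ordinal j : 'I_L is 0-based, so the j-th digit has weight 2^-(j+1). *)
Definition P_NMDT (R : realType) (L : nat) : set (nmdt_point R L) :=
  [set p |
    [/\ nx p = \sum_(j < L) 2 ^- j.+1 * nbeta p 0 j + nDx p,
        nz p = \sum_(j < L) 2 ^- j.+1 * nu p 0 j + nDz p,
        forall j : 'I_L,
          mccormick 0 1 0 1 (ny p, nbeta p 0 j, nu p 0 j),
        mccormick 0 (2 ^- L) 0 1 (nDx p, ny p, nDz p) &
        [/\ 0 <= nDx p <= 2 ^- L,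
            0 <= ny p <= 1 &
            forall j : 'I_L, nbeta p 0 j = 0 \/ nbeta p 0 j = 1]]].

Definition proj_xyz (R : realType) (L : nat) (P : set (nmdt_point R L)) :
    set (R * R * R) :=
  [set (nx p, ny p, nz p) | p in P].

Definition is_maximum (R : realType) (A : set R) (m : R) : Prop :=
  A m /\ ubound A m.

(* e is the maximum (attained, not merely the supremum) of |z - f x y| over
   the points (x, y, z) of the projection of P; with f x y = x * y this is the
   maximum error of P with respect to the graph of z = x * y. *)
Definition is_max_error (R : realType) (L : nat) (P : set (nmdt_point R L))
    (f : R -> R -> R) (e : R) : Prop :=
  is_maximum [set `|t.2 - f t.1.1 t.1.2| | t in proj_xyz P] e.

(* Main.v *)
Require Import Defs.
From mathcomp Require Import all_boot all_order all_algebra.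
From mathcomp Require Import all_classical all_reals.
From mathcomp Require Import ring lra.
Import Order.TTheory GRing.Theory Num.Theory.
Local Open Scope classical_set_scope.
Local Open Scope ring_scope.

(* A McCormick envelope is exact when one of its variables sits at a bound, so
   u_j = y beta_j for binary beta_j, and z - x y reduces to the error
   Delta_z - Delta_x y of the single remaining envelope.  On a box of sides
   a and b that error is at most a b / 4, with equality at the center. *)

(** Here [a + b] and [c + d] stand for the sides of a box, each cut in two by the coordinate of a
    point. A positive [t] is at most the geometric mean of its two bounds. *)
Lemma le_mul_mul_quarter (R : realFieldType) (a b c d t : R) :
  0 <= a -> 0 <= b -> 0 <= c -> 0 <= d -> t <= a * c -> t <= b * d ->
  t <= (a + b) * (c + d) / 4.
Proof.
move=> a0 b0 c0 d0 tac tbd.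
have [t0|t0] := leP t 0.
  by apply: le_trans t0 _; rewrite divr_ge0 ?mulr_ge0 ?addr_ge0.
rewrite ler_pdivlMr // -ler_sqr ?nnegrE; last 2 first.
- by rewrite mulr_ge0 // ltW.
- by rewrite mulr_ge0 ?addr_ge0.
have tt : t * t <= (a * b) * (c * d).
  have -> : (a * b) * (c * d) = (a * c) * (b * d) by ring.
  by apply: ler_pM => //; exact: ltW.
(* t^2 <= (ab)(cd), and AM-GM bounds each of the two factors *)
have ab : 4 * (a * b) <= (a + b) ^+ 2.
  by have := sqr_ge0 (a - b); rewrite !expr2; lra.
have cd : 4 * (c * d) <= (c + d) ^+ 2.
  by have := sqr_ge0 (c - d); rewrite !expr2; lra.
rewrite [leRHS]exprMn; apply: le_trans (ler_pM _ _ ab cd); rewrite ?mulr_ge0 //.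
by rewrite expr2; lra.
Qed.

(** Subtracting [p * q] turns each of the four envelope inequalities into a bound by a product of
    distances from [p] and [q] to their bounds. *)
Lemma mccormick_error (R : realType) (pl pu ql qu p q r : R) :
  mccormick pl pu ql qu (p, q, r) ->
  `|r - p * q| <= (pu - pl) * (qu - ql) / 4.
Proof.
case=> /andP[plp ppu] /andP[qlq qqu] /andP[r1 r2] /andP[r3 r4].
have -> : (pu - pl) * (qu - ql) =
    ((pu - p) + (p - pl)) * ((q - ql) + (qu - q)) by ring.
rewrite ler_norml lerNl; apply/andP; split.
  (* The underestimators give [(pu - p) * (qu - q)] and [(p - pl) * (q - ql)], the overestimators
     the crossed products; hence the swap on this side only. *)
  rewrite [(q - ql) + _]addrC.
  by apply: le_mul_mul_quarter; rewrite ?subr_ge0 //; lra.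
by apply: le_mul_mul_quarter; rewrite ?subr_ge0 //; lra.
Qed.

Lemma mccormick_binary (R : realType) (p q r : R) :
  q = 0 \/ q = 1 -> mccormick 0 1 0 1 (p, q, r) -> r = p * q.
Proof.
by case=> -> [_ _ /andP[r1 r2] /andP[r3 r4]]; apply/eqP; rewrite eq_le; lra.
Qed.

Lemma P_NMDT_error (R : realType) (L : nat) (p : nmdt_point R L) :
  P_NMDT p -> nz p - nx p * ny p = nDz p - nDx p * ny p.
Proof.
case=> xE zE uP _ [_ _ betaP].
rewrite xE zE mulrDl mulr_suml opprD addrACA -sumrB big1 ?add0r // => j _.
by rewrite (mccormick_binary _ _ _ _ (betaP j) (uP j)); ring.
Qed.

(** With all digits zero, [x] equals its remainder, placed with [y] at the center of the remaining
    box. Both underestimators vanish there, so [nDz] takes its least admissible value 0. *)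
Definition center_point (R : realType) (L : nat) : nmdt_point R L :=
  NMDTPoint (2 ^- L / 2) (1 / 2) 0 (2 ^- L / 2) 0 0 0.

Lemma P_NMDT_center (R : realType) (L : nat) : P_NMDT (center_point R L).
Proof.
have d0 : 0 <= 2 ^- L :> R by rewrite invr_ge0 exprn_ge0.
have sum0 : \sum_(j < L) 2 ^- j.+1 * (0 : 'rV[R]_L) 0 j = 0.
  by rewrite big1 // => j _; rewrite mxE mulr0.
split; rewrite /= ?sum0 ?add0r //.
- by move=> j; rewrite mxE; split; lra.
- by split; lra.
- by split; [lra|lra|move=> j; rewrite mxE; left].
Qed.

Theorem proposition1 (R : realType) (L : nat) (hL : (1 <= L)%N) :
  is_max_error (@P_NMDT R L) (fun x y => x * y) (1 / 4 * (2 ^- L * 1)) /\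
  1 / 4 * (2 ^- L * 1) = 2 ^- (L + 2) :> R.
Proof.
split; last by rewrite exprD invfM mulr1 mulrC mul1r expr2 -natrM.
split.
- exists (2 ^- L / 2, 1 / 2, 0) => /=.
    by exists (center_point R L) => //; exact: P_NMDT_center.
  have d0 : 0 <= 2 ^- L :> R by rewrite invr_ge0 exprn_ge0.
  by rewrite sub0r normrN ger0_norm; lra.
- move=> _ [_ [p Pp <-] <-] /=; rewrite (P_NMDT_error _ _ _ Pp).
  case: Pp => _ _ _ /mccormick_error err _.
  by apply: le_trans err _; lra.
Qed.
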